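(* Let $(\mathfrak g,\theta,d)$ be a hermitian Lie algebra with $\mathfrak g=\mathfrak k\oplus\mathfrak p$ such that $\mathfrak k/\mathfrak z(\mathfrak k)$ has no open invariant cones. Then every non-empty open invariant convex cone $W\subseteq\mathfrak g$ intersects $\mathfrak z(\mathfrak k)$.
   Context: Hermitian Lie algebra: $\mathfrak g$ a real Banach–Lie algebra, $\theta$ a continuous involutive automorphism with eigenspaces $\mathfrak k=\ker(\theta-\mathbf1)$, $\mathfrak p=\ker(\theta+\mathbf 1)$, $d\in\mathfrak z(\mathfrak k)$, such that $\mathfrak p$ is a complex Hilbert space, $\mathrm{ad}\,x|_\mathfrak p$ ($x\in\mathfrak k$) is bounded skew-hermitian, $[d,x]=ix$ for $x\in\mathfrak p$, and $\{x\in\mathfrak k:[x,\mathfrak p]=0\}\subseteq\mathfrak z(\mathfrak k)$. An open invariant cone in a Banach–Lie algebra $\mathfrak l$ is an open convex cone ($W+W\subseteq W$, $tW\subseteq W$ for $t>0$) invariant under all $e^{\mathrm{ad}\,x}$, $x\in\mathfrak l$; $\mathfrak l$ has no open invariant cones if each non-empty such cone equals $\mathfrak l$. *)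

(* Defs.v *)
From mathcomp Require Import all_boot all_order all_algebra.
From mathcomp Require Import all_classical all_reals all_analysis.
From mathcomp.real_closed Require Export complex.
Export numFieldNormedType.Exports.

Set Implicit Arguments.
Unset Strict Implicit.
Unset Printing Implicit Defensive.
Import Order.TTheory GRing.Theory Num.Theory.
Local Open Scope ring_scope.
Local Open Scope classical_set_scope.
Local Open Scope complex_scope.

Section Defs.
Variables (R : realType) (g : completeNormedModType R).

Definition banach_lie (br : g -> g -> g) : Prop :=
  [/\ (forall (a : R) x y z, br (a *: x + y) z = a *: br x z + br y z),
      (forall x y, br x y = - br y x),
      (forall x y z, br x (br y z) + br y (br z x) + br z (br x y) = 0)
    & continuous (fun xy : g * g => br xy.1 xy.2)].

Definition cont_inv_aut (br : g -> g -> g) (theta : g -> g) : Prop :=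
  [/\ (forall (a : R) x y, theta (a *: x + y) = a *: theta x + theta y),
      continuous theta,
      (forall x, theta (theta x) = x)
    & (forall x y, theta (br x y) = br (theta x) (theta y))].

Definition kpart (theta : g -> g) : set g := [set x | theta x = x].
Definition ppart (theta : g -> g) : set g := [set x | theta x = - x].

Definition lie_center (br : g -> g -> g) (L : set g) : set g :=
  [set z | L z /\ forall x, L x -> br z x = 0].

Definition expad (br : g -> g -> g) (x y : g) : g :=
  limn (series (fun n => (n`!%:R)^-1 *: iter n (br x) y)).

(** [p = ppart theta] is a complex Hilbert space whose complex structure is
    [i . u := [d, u]] (this encodes the axiom [[d,x] = i x] for x in p),
    with complex inner product [ip] (linear in the first argument), whose
    norm is equivalent to the Banach norm of g on p; and for x in k,
    ad x |_p is skew-hermitian. *)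
Definition hermitian_lie_alg (br : g -> g -> g) (theta : g -> g) (d : g)
  (ip : g -> g -> R[i]) : Prop :=
  [/\ banach_lie br /\ cont_inv_aut br theta,
      lie_center br (kpart theta) d,
      [/\ (forall u v w, ppart theta u -> ppart theta v -> ppart theta w ->
             ip (u + v) w = ip u w + ip v w),
          (forall (a : R) u w, ppart theta u -> ppart theta w ->
             ip (a *: u) w = a%:C * ip u w),
          (forall u w, ppart theta u -> ppart theta w ->
             ip (br d u) w = 'i * ip u w),
          (forall u w, ppart theta u -> ppart theta w -> ip w u = (ip u w)^*)
        & exists c c' : R, [/\ 0 < c, 0 < c' & forall u, ppart theta u ->
             ((c * `|u| ^+ 2)%:C <= ip u u) /\ (ip u u <= (c' * `|u| ^+ 2)%:C)]],
      (forall x u w, kpart theta x -> ppart theta u -> ppart theta w ->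
          ip (br x u) w = - ip u (br x w))
    & (forall x, kpart theta x -> (forall u, ppart theta u -> br x u = 0) ->
          lie_center br (kpart theta) x)].

Definition open_inv_cone (br : g -> g -> g) (L W : set g) : Prop :=
  [/\ W `<=` L,
      (exists U : set g, open U /\ W = U `&` L),
      (forall x y, W x -> W y -> W (x + y)),
      (forall (t : R) x, 0 < t -> W x -> W (t *: x))
    & (forall x y, L x -> W y -> W (expad br x y))].

Definition open_inv_cone_g (br : g -> g -> g) (W : set g) : Prop :=
  open_inv_cone br setT W.

(** A subset of the quotient
    k/z(k) is identified with its (z(k)-saturated) preimage in k under the
    quotient map q; q^{-1} is a bijection between subsets of k/z(k) and
    z(k)-saturated subsets of k, and C is open / a convex cone /
    e^{ad q(x)}-invariant / equal to k/z(k) iff q^{-1}(C) is open in k /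
    a convex cone / e^{ad x}-invariant / equal to k. *)
Definition quotient_no_open_inv_cones (br : g -> g -> g) (theta : g -> g)
  : Prop :=
  forall W : set g,
    open_inv_cone br (kpart theta) W ->
    (forall x z, W x -> lie_center br (kpart theta) z -> W (x + z)) ->
    W !=set0 -> W = kpart theta.

End Defs.

(* Main.v *)
Require Import Defs.
From mathcomp Require Import all_boot all_order all_algebra.
From mathcomp Require Import all_classical all_reals all_analysis.
From mathcomp.real_closed Require Import complex.
From mathcomp Require Import ring lra.
Import Order.TTheory GRing.Theory Num.Theory.
Local Open Scope ring_scope.
Local Open Scope classical_set_scope.
Local Open Scope complex_scope.

(* On [p], the positive definite form [ip] satisfies
   [ip ([d, u]) w = 'i * ip u w], which forces [ad d ^ 2 = -1] there, while
   [ad d] vanishes on [k].  Hence [exp (pi ad d)] is [+1] on [k] and [-1] on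
   [p], so for [w = w_k + w_p] in [W] the invariant cone also contains
   [w_k = (w + exp (pi ad d) w) / 2].  The [z(k)]-saturation
   [{x in k | x + z in W for some z in z(k)}] is then a non-empty open
   invariant cone of [k/z(k)], hence all of [k]; as it contains [0], [W] meets
   [z(k)]. *)

Section LinearFun.
Context {R : pzRingType} {U V : lmodType R} {f : U -> V}.
Hypothesis f_lin : linear f.

Lemma lin0 : f 0 = 0.
Proof.
have f00 := f_lin 1 0 0; rewrite !scale1r addr0 in f00.
by apply: (addrI (f 0)); rewrite addr0 -f00.
Qed.

Lemma linD x y : f (x + y) = f x + f y.
Proof. by have := f_lin 1 x y; rewrite !scale1r. Qed.

Lemma linZ a x : f (a *: x) = a *: f x.
Proof. by rewrite -[a *: x]addr0 f_lin lin0 addr0. Qed.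

Lemma linN x : f (- x) = - f x.
Proof. by rewrite -scaleN1r linZ scaleN1r. Qed.

Lemma lin_sum (I : Type) (r : seq I) (P : pred I) (F : I -> U) :
  f (\sum_(i <- r | P i) F i) = \sum_(i <- r | P i) f (F i).
Proof. exact: (big_morph f linD lin0). Qed.

End LinearFun.

Lemma half_double (R : realFieldType) (V : lmodType R) (y : V) :
  (2 : R)^-1 *: (y + y) = y.
Proof.
by rewrite scalerDr -scalerDl (_ : 2^-1 + 2^-1 = 1) ?scale1r //; lra.
Qed.

Lemma bilinear_bounded (R : realType) (U : normedModType R) (f : U -> U -> U) :
  (forall (a : R) x z, f (a *: x) z = a *: f x z) ->
  (forall (a : R) x z, f z (a *: x) = a *: f z x) ->
  continuous (fun p : U * U => f p.1 p.2) ->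
  exists2 k, k > 0 & forall u v, `|f u v| <= k * `|u| * `|v|.
Proof.
move=> fZl fZr.
have f0r u : f u 0 = 0 by have := fZr 0 0 u; rewrite !scale0r.
have f0l u : f 0 u = 0 by have := fZl 0 0 u; rewrite !scale0r.
move=> /(_ 0); rewrite /continuous_at /= f0r => /(_ _ (nbhsx_ballx _ _ ltr01)).
move=> /nbhs_ballP [_ /posnumP[e] he]; exists ((2 / e%:num) ^+2) => // u v.
have [|un0] := real_le0P (normr_real u).
  by rewrite normr_le0 => /eqP->; rewrite f0l !normr0 mulr0 mul0r.
have [|vn0] := real_le0P (normr_real v).
  by rewrite normr_le0 => /eqP->; rewrite f0r !normr0 mulr0.
rewrite -[`|u|]/((PosNum un0)%:num) -[`|v|]/((PosNum vn0)%:num).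
set ku := 2 / e%:num * (PosNum un0)%:num.
set kv := 2 / e%:num * (PosNum vn0)%:num.
rewrite -[X in f X](@scalerKV _ _ ku) /ku // fZl normrZ.
rewrite gtr0_norm // -ler_pdivlMl //.
rewrite -[X in f _ X](@scalerKV _ _ kv) /kv // fZr normrZ.
rewrite gtr0_norm // -ler_pdivlMl //.
suff /he : ball 0 e%:num (ku^-1 *: u, kv^-1 *: v).
  rewrite -ball_normE /= distrC subr0 => /ltW /le_trans; apply.
  rewrite ler_pdivlMl 1?pmulr_lgt0// mulr1 ler_pdivlMl 1?pmulr_lgt0//.
  by rewrite mulrA [ku * _]mulrAC expr2.
rewrite -ball_normE /= distrC subr0.
have -> : (ku^-1 *: u, kv^-1 *: v) =
    (e%:num / 2) *: ((PosNum un0)%:num ^-1 *: u, (PosNum vn0)%:num ^-1 *: v).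
  by rewrite invfM [kv ^-1]invfM invf_div -[_ *: u]scalerA -[_ *: v]scalerA.
rewrite normrZ ger0_norm // -mulrA gtr_pMr // ltr_pdivrMl // mulr1.
by rewrite prod_normE/= !normrZ !normfV !normr_id !mulVf ?gt_eqF// maxxx ltr1n.
Qed.

Lemma is_cvg_exp_series_iter (R : realType) (V : completeNormedModType R)
  (f : V -> V) (K : R) (y : V) :
  0 <= K -> (forall v, `|f v| <= K * `|v|) ->
  cvgn (series (fun n => (n`!%:R)^-1 *: iter n f y)).
Proof.
move=> K0 f_bound; apply: normed_cvg.
have iter_bound n : `|iter n f y| <= K ^+ n * `|y|.
  elim: n => [|n IH] /=; first by rewrite expr0 mul1r.
  by apply: le_trans (f_bound _) _; rewrite exprS -mulrA ler_wpM2l.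
apply: (@series_le_cvg R _ (fun n => exp_coeff K n * `|y|)).
- by move=> n; rewrite normr_ge0.
- by move=> n; rewrite mulr_ge0 // exp_coeff_ge0.
- move=> n /=; rewrite normrZ ger0_norm ?invr_ge0 // /exp_coeff /=.
  by rewrite mulrAC mulrC ler_wpM2r // invr_ge0.
- have -> : series (fun n => exp_coeff K n * `|y|) =
      series (exp_coeff K) \* (fun=> `|y|).
    by apply/funext => N; rewrite /series /= mulr_suml.
  by apply: is_cvgMr_tmp; exact: is_cvg_series_exp_coeff.
Qed.

Lemma cvg_series_scaler (R : realType) (V : normedModType R) (c : nat -> R)
  (l : R) (v : V) :
  series c @ \oo --> l -> series (fun n => c n *: v) @ \oo --> l *: v.
Proof.
have -> : series (fun n => c n *: v) = (fun N => series c N *: v).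
  by apply/funext => N; rewrite /series /= scaler_suml.
exact: cvgZr_tmp.
Qed.

Section ComplexStructure.
Context {R : realType} {V : normedModType R} {J : V -> V} {u : V}.
Hypotheses (J_lin : linear J) (J2u : J (J u) = - u).

Lemma iter_complex_structure n :
  iter n J u = ((~~ odd n)%:R * (-1) ^+ n./2) *: u
             + ((odd n)%:R * (-1) ^+ n.-1./2) *: J u.
Proof.
elim: n => [|n IH]; first by rewrite mul1r expr0 scale1r mul0r scale0r addr0.
rewrite iterS IH (linD J_lin) !(linZ J_lin) J2u scalerN -scaleNr addrC.
rewrite -(odd_double_half n); move: (n./2) => m; case: (odd n) => /=.
- by rewrite !odd_double /= !mul1r !mul0r add0n doubleK exprS mulN1r.
- by rewrite !add0n !odd_double /= !mul1r !mul0r oppr0.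
Qed.

Lemma exp_series_complex_structure (x : R) :
  series (fun n => (n`!%:R)^-1 *: iter n (fun v => x *: J v) u) @ \oo -->
  cos x *: u + sin x *: J u.
Proof.
have iterZ n v : iter n (fun v => x *: J v) v = x ^+ n *: iter n J v.
  elim: n => [|n IH]; first by rewrite expr0 scale1r.
  by rewrite /= IH (linZ J_lin) scalerA exprS.
have -> : (fun n => (n`!%:R)^-1 *: iter n (fun v => x *: J v) u) =
    (fun n => cos_coeff x n *: u) + (fun n => sin_coeff x n *: J u).
  apply/funext => n; rewrite iterZ iter_complex_structure !scalerDr !scalerA /=.
  by congr (_ *: _ + _ *: _); rewrite /cos_coeff /sin_coeff /= -?exprnP; ring.
rewrite seriesD; apply: cvgD; apply: cvg_series_scaler; rewrite unlock.
- exact: is_cvg_series_cos_coeff.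
- exact: is_cvg_series_sin_coeff.
Qed.

End ComplexStructure.

Section BanachLie.
Context {R : realType} {g : completeNormedModType R} {br : g -> g -> g}.
Hypotheses (br_linl : forall z, linear (br^~ z))
  (br_anti : forall x y, br x y = - br y x)
  (br_cont : continuous (fun xy : g * g => br xy.1 xy.2)).

Lemma br_linr z : linear (br z).
Proof. by move=> a x y; rewrite br_anti br_linl opprD -scalerN -!br_anti. Qed.

Lemma brDl x y z : br (x + y) z = br x z + br y z.
Proof. exact: (linD (br_linl z)). Qed.

Lemma brZl a x z : br (a *: x) z = a *: br x z.
Proof. exact: (linZ (br_linl z)). Qed.

Lemma expad_cvg x y : cvgn (series (fun n => (n`!%:R)^-1 *: iter n (br x) y)).
Proof.
have [K K0 br_bound] :=
  @bilinear_bounded _ _ br brZl (fun a x z => linZ (br_linr z) a x) br_cont.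
apply: (@is_cvg_exp_series_iter _ _ _ (K * `|x|)) => [|v].
  by rewrite mulr_ge0 // ltW.
exact: br_bound.
Qed.

Lemma expad_addr x y z : br x z = 0 -> expad br x (y + z) = expad br x y + z.
Proof.
move=> xz0; rewrite /expad; apply: cvg_lim => //.
apply: cvg_trans (cvgD (expad_cvg x y) (cvg_cst z)).
apply: near_eq_cvg; near=> N; have [M ->] : exists M, N = M.+1.
  by exists N.-1; rewrite prednK //; near: N; exact: nbhs_infty_gt.
rewrite !fctE /series /= !big_nat_recl //= fact0 invr1 !scale1r addrAC.
congr (_ + _ + _).
apply: eq_bigr => i _; rewrite -!iterS !iterSr.
by rewrite (linD (br_linr x)) xz0 addr0.
Unshelve. all: by end_near.
Qed.

Lemma expad_commute (T : g -> g) x y : linear T -> continuous T ->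
  (forall v, T (br x v) = br x (T v)) -> T (expad br x y) = expad br x (T y).
Proof.
move=> T_lin T_cont Tx.
have iterT n v : T (iter n (br x) v) = iter n (br x) (T v).
  by elim: n => [|n IH] //=; rewrite Tx IH.
rewrite /expad; apply/esym/cvg_lim => //.
have -> : series (fun n => (n`!%:R)^-1 *: iter n (br x) (T y)) =
    T \o series (fun n => (n`!%:R)^-1 *: iter n (br x) y).
  apply/funext => N; rewrite /series /= (lin_sum T_lin).
  by apply: eq_bigr => n _; rewrite (linZ T_lin) iterT.
exact: (cvg_comp _ _ (expad_cvg x y) (T_cont _)).
Qed.

End BanachLie.

Lemma coercive_form_definite {R : realType} {V : normedModType R} {c : R}
  {u : V} {z : R[i]} : 0 < c -> (c * `|u| ^+ 2)%:C <= z -> z = 0 -> u = 0.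
Proof.
move=> c0 + z0; rewrite z0 lecR pmulr_rle0 // => u2.
by apply/normr0_eq0/eqP; rewrite -sqrf_eq0 eq_le u2 sqr_ge0.
Qed.

(* [v := J (J u) + u] is isotropic: [ip v v = ('i ^+ 2 + 1) * ip u v = 0]. *)
Lemma complex_structure_sqr (R : realType) (V : normedModType R) (P : set V)
  (J : V -> V) (ip : V -> V -> R[i]) :
  (forall u v, P u -> P v -> P (u + v)) -> (forall u, P u -> P (J u)) ->
  (forall u v w, P u -> P v -> P w -> ip (u + v) w = ip u w + ip v w) ->
  (forall u w, P u -> P w -> ip (J u) w = 'i * ip u w) ->
  (forall u, P u -> ip u u = 0 -> u = 0) ->
  forall u, P u -> J (J u) = - u.
Proof.
move=> PD PJ ipD ipJ ip_def u Pu; apply/eqP; rewrite -addr_eq0; apply/eqP.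
have PJu := PJ _ Pu; have PJJu := PJ _ PJu; have Pv := PD _ _ PJJu Pu.
apply: ip_def => //; rewrite ipD // !ipJ //.
by rewrite mulrA -expr2 sqr_i mulN1r addNr.
Qed.

Section HermitianLieAlgebra.
Context {R : realType} {g : completeNormedModType R} {br : g -> g -> g}
  {theta : g -> g} {d : g}.
Hypotheses (br_linl : forall z, linear (br^~ z))
  (br_anti : forall x y, br x y = - br y x)
  (br_cont : continuous (fun xy : g * g => br xy.1 xy.2))
  (theta_lin : linear theta) (theta_cont : continuous theta)
  (theta_inv : forall x, theta (theta x) = x)
  (theta_br : forall x y, theta (br x y) = br (theta x) (theta y))
  (d_fixed : theta d = d) (d_central : forall x, kpart theta x -> br d x = 0)
  (ad_d_sqr : forall u, ppart theta u -> br d (br d u) = - u).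

Local Notation k := (kpart theta).
Local Notation p := (ppart theta).
Local Notation zk := (lie_center br (kpart theta)).

Lemma kpartD x y : k x -> k y -> k (x + y).
Proof. by rewrite /kpart /= (linD theta_lin) => -> ->. Qed.

Lemma kpartZ a x : k x -> k (a *: x).
Proof. by rewrite /kpart /= (linZ theta_lin) => ->. Qed.

Lemma ppartD x y : p x -> p y -> p (x + y).
Proof. by rewrite /ppart /= (linD theta_lin) opprD => -> ->. Qed.

Lemma ppart_ad_d u : p u -> p (br d u).
Proof.
rewrite /ppart /= theta_br d_fixed => ->.
exact: (linN (br_linr br_linl br_anti d)).
Qed.

Lemma lie_center0 : zk 0.
Proof.
by split=> [|x _]; [exact: (lin0 theta_lin) | exact: (lin0 (br_linl x))].
Qed.

Lemma lie_centerD z z' : zk z -> zk z' -> zk (z + z').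
Proof.
move=> [kz zz] [kz' zz']; split=> [|x kx]; first exact: kpartD.
by rewrite brDl // zz // zz' // addr0.
Qed.

Lemma lie_centerZ a z : zk z -> zk (a *: z).
Proof.
move=> [kz zz]; split=> [|x kx]; first exact: kpartZ.
by rewrite brZl // zz // scaler0.
Qed.

Lemma kpart_ppart_decomp y : exists yk yp, [/\ k yk, p yp & y = yk + yp].
Proof.
exists ((2 : R)^-1 *: (y + theta y)), ((2 : R)^-1 *: (y - theta y)); split.
- by rewrite /kpart /= (linZ theta_lin) (linD theta_lin) theta_inv addrC.
- rewrite /ppart /= (linZ theta_lin) (linD theta_lin) (linN theta_lin).
  by rewrite theta_inv -scalerN opprB addrC.
- by rewrite -scalerDr addrACA subrr addr0 half_double.
Qed.

Lemma expad_kpart x y : k x -> k y -> k (expad br x y).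
Proof.
move=> kx ky; rewrite /kpart /= expad_commute // ?ky // => v.
by rewrite theta_br kx.
Qed.

(* On [p], [ad d] acts as ['i], so [exp (pi ad d)] acts as [exp (pi 'i)]. *)
Lemma expad_pid_ppart u : p u -> expad br (pi *: d) u = - u.
Proof.
move=> pu; have brd_lin := br_linr br_linl br_anti d; rewrite /expad.
have -> : br (pi *: d) = fun v => pi *: br d v.
  by apply/funext => v; rewrite brZl.
have := exp_series_complex_structure brd_lin (ad_d_sqr u pu) pi.
move=> /cvg_lim -> //.
by rewrite cospi sinpi scale0r addr0 scaleN1r.
Qed.

Lemma expad_pid yk yp : k yk -> p yp -> expad br (pi *: d) (yk + yp) = yk - yp.
Proof.
move=> kyk pyp.
have pid_yk : br (pi *: d) yk = 0 by rewrite brZl // d_central // scaler0.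
rewrite addrC (expad_addr br_linl br_anti br_cont _ yp _ pid_yk).
by rewrite expad_pid_ppart // addrC.
Qed.

Lemma inv_cone_meets_kpart W : open_inv_cone_g br W -> W !=set0 ->
  exists2 y, k y & W y.
Proof.
move=> [_ _ WD WZ Wexpad] [w Ww].
have [yk [yp [kyk pyp w_eq]]] := kpart_ppart_decomp w; subst w.
exists yk => //.
have W2yk : W (yk + yp + (yk - yp)).
  by apply: WD => //; rewrite -expad_pid //; exact: Wexpad.
have := WZ (2 : R)^-1 _ _ W2yk; rewrite invr_gt0 ltr0n => /(_ isT).
by rewrite addrACA subrr addr0 half_double.
Qed.

Definition center_saturation (W : set g) : set g :=
  [set x | k x /\ exists2 z, zk z & W (x + z)].

Lemma center_saturationD W x z :
  center_saturation W x -> zk z -> center_saturation W (x + z).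
Proof.
move=> [kx [z' zkz' Wxz']] zkz; split; first by apply: kpartD => //; case: zkz.
exists (z' - z).
  by apply: lie_centerD => //; rewrite -scaleN1r; exact: lie_centerZ.
by rewrite addrACA subrr addr0.
Qed.

Lemma center_saturation_open_inv_cone W :
  open_inv_cone_g br W -> open_inv_cone br k (center_saturation W).
Proof.
move=> [_ [U [oU WU]] WD WZ Wexpad]; split.
- by move=> x [].
- exists (\bigcup_(z in zk) ((fun x => x + z) @^-1` W)); split.
    apply: bigcup_open => z _; apply: open_comp; last by rewrite WU setIT.
    by move=> x _; apply: continuousD; [exact: cvg_id | exact: cvg_cst].
  apply/seteqP; split=> x.
    by move=> [kx [z zkz Wxz]]; split=> //; exists z.
  by move=> [[z zkz Wxz] kx]; split=> //; exists z.
- move=> x y [kx [z zkz Wxz]] [ky [z' zkz' Wyz']]; split; first exact: kpartD.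
  exists (z + z'); first exact: lie_centerD.
  by rewrite addrACA; exact: WD.
- move=> t x t0 [kx [z zkz Wxz]]; split; first exact: kpartZ.
  exists (t *: z); first exact: lie_centerZ.
  by rewrite -scalerDr; exact: WZ.
- move=> x y kx [ky [z [kz zz] Wyz]]; split; first exact: expad_kpart.
  have xz0 : br x z = 0 by rewrite br_anti zz // oppr0.
  exists z => //; rewrite -(expad_addr br_linl br_anti br_cont _ _ _ xz0).
  exact: Wexpad.
Qed.

Lemma inv_cone_meets_center : quotient_no_open_inv_cones br theta ->
  forall W, open_inv_cone_g br W -> W !=set0 -> exists z, W z /\ zk z.
Proof.
move=> no_cones W oicW [w Ww].
have [y ky Wy] := inv_cone_meets_kpart W oicW (ex_intro _ w Ww).
have : center_saturation W 0.
  rewrite (no_cones _ (center_saturation_open_inv_cone W oicW)).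
  - exact: (lin0 theta_lin).
  - exact: center_saturationD.
  - by exists y; split=> //; exists 0; [exact: lie_center0 | rewrite addr0].
by move=> [_ [z zkz Wz]]; exists z; rewrite add0r in Wz.
Qed.

End HermitianLieAlgebra.

Theorem proposition4p11 (R : realType) (g : completeNormedModType R)
  (br : g -> g -> g) (theta : g -> g) (d : g) (ip : g -> g -> R[i]) :
  hermitian_lie_alg br theta d ip ->
  quotient_no_open_inv_cones br theta ->
  forall W : set g, open_inv_cone_g br W -> W !=set0 ->
    exists z, W z /\ lie_center br (kpart theta) z.
Proof.
move=> [[[br_lin br_anti _ br_cont] [theta_lin theta_cont theta_inv theta_br]]
  [d_fixed d_central] [ipD _ ipd _ [c [c' [c0 _ ip_coercive]]]] _ _].
have br_linl z : linear (br^~ z) by move=> a x y; exact: br_lin.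
have ad_d_sqr : forall u, ppart theta u -> br d (br d u) = - u.
  apply: (@complex_structure_sqr _ _ _ _ ip (ppartD theta_lin)) => //.
  - exact: (ppart_ad_d br_linl br_anti theta_br d_fixed).
  - move=> u pu; case: (ip_coercive u pu) => ipuu _.
    exact: coercive_form_definite c0 ipuu.
exact: (inv_cone_meets_center br_linl br_anti br_cont theta_lin theta_cont
  theta_inv theta_br d_central ad_d_sqr).
Qed.
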